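(* Let $n\in\mathbb{N}$ and let $(U^{(i)}_{A_iB_i})_{i=1}^n$ be a family of two-qubit unitaries, where $U^{(i)}_{A_iB_i}$ acts on qubits $A_i$ and $B_i$ and has KAK parameters $(u^{(i)}_0,u^{(i)}_1,u^{(i)}_2,u^{(i)}_3)$. Let $A=\bigotimes_{i=1}^nA_i$, $B=\bigotimes_{i=1}^nB_i$ and $U_{AB}=\bigotimes_{i=1}^nU^{(i)}_{A_iB_i}$. Then $$\gamma_{\mathrm{LO}(A,B)}(U_{AB})=\gamma_{\mathrm{LOCC}(A,B)}(U_{AB})=1+2\sum_{\mathbf{k}\neq\mathbf{k}'}|u_{\mathbf{k}}|\,|u_{\mathbf{k}'}| ,$$ where the sum is over all ordered pairs of distinct $\mathbf{k},\mathbf{k}'\in\{0,1,2,3\}^n$ and $u_{\mathbf{k}}=\prod_{i=1}^nu^{(i)}_{k_i}$.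
   Context: All Hilbert spaces are finite-dimensional. $\mathrm{CPTP}(X)$ is the set of completely positive trace-preserving maps on system $X$. KAK parameters: every two-qubit unitary $U$ on qubits $A_1\otimes B_1$ can be written as $U=(V_1\otimes V_2)\big(\sum_{k=0}^3 u_k\,\sigma_k\otimes\sigma_k\big)(V_3\otimes V_4)$ with single-qubit unitaries $V_1,\dots,V_4$, $\sigma_0=\mathds{1}$, $\sigma_1,\sigma_2,\sigma_3$ the Pauli matrices $X,Y,Z$, and $u_k\in\mathbb{C}$ with $\sum_k|u_k|^2=1$. The $u_k$ are called the KAK parameters of $U$. Local operations: $\mathcal{N}(X)=\{\mathcal{A}^+-\mathcal{A}^-:\ \mathcal{A}^\pm \text{ completely positive},\ \mathcal{A}^++\mathcal{A}^-\in\mathrm{CPTP}(X)\}$ and $\mathrm{LO}(A,B)=\{\mathcal{F}_A\otimes\mathcal{F}_B:\ \mathcal{F}_A\in\mathcal{N}(A),\ \mathcal{F}_B\in\mathcal{N}(B)\}$. LOCC: an instrument is a finite family $(\mathcal{E}_i)$ of completely positive maps whose sum is trace preserving. A one-way local instrument from $A$ has the form $(\mathcal{E}_i\otimes\mathcal{T}_i)_i$ with $(\mathcal{E}_i)$ an instrument on $A$ and each $\mathcal{T}_i$ CPTP on $B$ (analogously from $B$). An LOCC instrument is obtained by finitely many rounds, in each of which a one-way local instrument (from $A$ or from $B$, possibly changing the local finite dimensions) is applied that may depend on all previous outcomes, followed by coarse-graining (summing) of outcomes. $\mathrm{LOCC}(A,B)$ is the set of maps $\sum_i s_i\mathcal{E}_i$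 on $AB$ with $(\mathcal{E}_i)$ an LOCC instrument and $s_i\in\{+1,-1\}$. $\gamma$-factor: for a linear map $\mathcal{E}$ on $AB$ and $S\in\{\mathrm{LO}(A,B),\mathrm{LOCC}(A,B)\}$, $\gamma_S(\mathcal{E})=\min\{\sum_{i=1}^m|a_i| : \mathcal{E}=\sum_{i=1}^m a_i\mathcal{F}_i,\ m\ge1,\ \mathcal{F}_i\in S,\ a_i\in\mathbb{R}\}$. For a unitary $U$, $\gamma_S(U)$ means $\gamma_S$ of the channel $\rho\mapsto U\rho U^\dagger$. *)

(* Defs.v *)
From HB Require Import structures.
From mathcomp Require Export all_boot all_order all_algebra.
From mathcomp Require Export classical_sets reals.
From mathcomp Require Export complex mxtens.

Set Implicit Arguments.
Unset Strict Implicit.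
Unset Printing Implicit Defensive.

Import Order.TTheory GRing.Theory Num.Theory.

Local Open Scope ring_scope.
Local Open Scope complex_scope.
Local Open Scope sesquilinear_scope.

(* The Hilbert space C^d is represented by its dimension d, the composite of
   C^dA and C^dB by dA * dB, with the product basis ordered as in mxtens. *)
Notation superop R d d' := 'Hom('M[R[i]]_d, 'M[R[i]]_d').

Section Channels.
Context {R : realType}.
Local Notation C := R[i].

(* Over R[i] the order 0 <= z forces z to be real, so X is then Hermitian. *)
Definition psd d (X : 'M[C]_d) : Prop :=
  forall v : 'cV[C]_d, 0 <= (v^t* *m X *m v) 0 0.

Section Tensor.
Context {m n p q : nat} (E : superop R m p) (F : superop R n q).

Definition tens_superop_fun (X : 'M[C]_(m * n)) : 'M[C]_(p * q) :=
  \sum_(i < m) \sum_(j < m) \sum_(k < n) \sum_(l < n)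
    X (mxtens_index (i, k)) (mxtens_index (j, l)) *:
      (E (delta_mx i j) *t F (delta_mx k l)).

Fact tens_superop_fun_is_linear : linear tens_superop_fun.
Proof.
move=> a X Y; rewrite /tens_superop_fun scaler_sumr -big_split /=.
apply: eq_bigr => i _; rewrite scaler_sumr -big_split /=.
apply: eq_bigr => j _; rewrite scaler_sumr -big_split /=.
apply: eq_bigr => k _; rewrite scaler_sumr -big_split /=.
by apply: eq_bigr => l _; rewrite !mxE scalerDl scalerA.
Qed.

HB.instance Definition _ :=
  GRing.isLinear.Build C 'M[C]_(m * n) 'M[C]_(p * q) _
    tens_superop_fun tens_superop_fun_is_linear.

Definition tens_superop : superop R (m * n) (p * q) := linfun tens_superop_fun.
End Tensor.

Definition CP d d' (E : superop R d d') : Prop :=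
  forall k (X : 'M[C]_(k * d)), psd X -> psd (tens_superop (\1%VF : superop R k k) E X).

Definition TP d d' (E : superop R d d') : Prop :=
  forall X : 'M[C]_d, \tr (E X) = \tr X.

Definition CPTP d d' (E : superop R d d') : Prop := CP E /\ TP E.

Section UnitaryChannel.
Context {d : nat} (U : 'M[C]_d).

Definition unitary_channel_fun (X : 'M[C]_d) : 'M[C]_d := U *m X *m U^t*.

Fact unitary_channel_fun_is_linear : linear unitary_channel_fun.
Proof.
by move=> a X Y; rewrite /unitary_channel_fun mulmxDr mulmxDl -scalemxAr -scalemxAl.
Qed.

HB.instance Definition _ :=
  GRing.isLinear.Build C 'M[C]_d 'M[C]_d _
    unitary_channel_fun unitary_channel_fun_is_linear.

Definition unitary_channel : superop R d d := linfun unitary_channel_fun.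
End UnitaryChannel.

Definition signed_local d : set (superop R d d) :=
  [set F | exists Fp Fm : superop R d d,
     [/\ CP Fp, CP Fm, CPTP (Fp + Fm) & F = Fp - Fm]].

Definition LO dA dB : set (superop R (dA * dB) (dA * dB)) :=
  [set F | exists (FA : superop R dA dA) (FB : superop R dB dB),
     [/\ @signed_local dA FA, @signed_local dB FB & F = tens_superop FA FB]].

Definition instrument d d' (I : finType) (E : I -> superop R d d') : Prop :=
  (forall i, CP (E i)) /\ TP (\sum_i E i).

Definition one_way_A dA dB dA' dB' (I : finType)
    (E : I -> superop R (dA * dB) (dA' * dB')) : Prop :=
  exists (EA : I -> superop R dA dA') (TB : I -> superop R dB dB'),
    [/\ instrument EA, forall i, CPTP (TB i)
      & forall i, E i = tens_superop (EA i) (TB i)].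

Definition one_way_B dA dB dA' dB' (I : finType)
    (E : I -> superop R (dA * dB) (dA' * dB')) : Prop :=
  exists (TA : I -> superop R dA dA') (EB : I -> superop R dB dB'),
    [/\ forall i, CPTP (TA i), instrument EB
      & forall i, E i = tens_superop (TA i) (EB i)].

(* Protocols as trees of finite depth: a first one-way local instrument, then,
   for each of its outcomes i, a protocol G i which may depend on i. The
   outcomes of the composite are the complete histories of outcomes. *)
Inductive locc_rounds (dA' dB' : nat) : forall (dA dB : nat) (I : finType),
    (I -> superop R (dA * dB) (dA' * dB')) -> Prop :=
| LoccDone :
    @locc_rounds dA' dB' dA' dB' unit (fun _ => \1%VF)
| LoccRound (dA dB dA1 dB1 : nat) (I : finType) (K : I -> finType)
    (E : I -> superop R (dA * dB) (dA1 * dB1))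
    (G : forall i, K i -> superop R (dA1 * dB1) (dA' * dB')) :
    @one_way_A dA dB dA1 dB1 I E \/ @one_way_B dA dB dA1 dB1 I E ->
    (forall i, @locc_rounds dA' dB' dA1 dB1 (K i) (G i)) ->
    @locc_rounds dA' dB' dA dB {i : I & K i}
      (fun h => (G (tag h) (tagged h) \o E (tag h))%VF).

Definition locc_instrument dA dB dA' dB' (J : finType)
    (E : J -> superop R (dA * dB) (dA' * dB')) : Prop :=
  exists (I : finType) (G : I -> superop R (dA * dB) (dA' * dB')) (f : I -> J),
    @locc_rounds dA' dB' dA dB I G /\
    forall j, E j = \sum_(i | f i == j) G i.

Definition LOCC dA dB : set (superop R (dA * dB) (dA * dB)) :=
  [set F | exists (I : finType) (E : I -> superop R (dA * dB) (dA * dB))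
                  (s : I -> bool),
     @locc_instrument dA dB dA dB I E /\ F = \sum_i (-1) ^+ s i *: E i].

Definition decomposition_costs d d' (S : set (superop R d d'))
    (E : superop R d d') : set R :=
  [set c | exists (m : nat) (a : 'I_m -> R) (F : 'I_m -> superop R d d'),
     [/\ (1 <= m)%N, forall i, S (F i),
         E = \sum_i (a i)%:C *: F i & c = \sum_i `|a i|]].

(* gamma_S(E) = g; a relation because gamma_S is a minimum, which need not be
   known in advance to exist. *)
Definition is_gamma d d' (S : set (superop R d d')) (E : superop R d d') (g : R)
    : Prop :=
  decomposition_costs S E g /\ lbound (decomposition_costs S E) g.

Definition mx22 (a b c d : C) : 'M[C]_2 :=
  \matrix_(i < 2, j < 2) nth 0 (nth [::] [:: [:: a; b]; [:: c; d]] i) j.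

Definition pauli (k : 'I_4) : 'M[C]_2 :=
  [:: mx22 1 0 0 1; mx22 0 1 1 0; mx22 0 (- 'i%C) 'i%C 0; mx22 1 0 0 (- 1)]`_k.

Definition KAK_parameters (U : 'M[C]_(2 * 2)) (u : 'I_4 -> C) : Prop :=
  \sum_k `|u k| ^+ 2 = 1 /\
  exists V1 V2 V3 V4 : 'M[C]_2,
    [/\ V1 \is unitarymx, V2 \is unitarymx, V3 \is unitarymx, V4 \is unitarymx
      & U = (V1 *t V2) *m (\sum_k u k *: (pauli k *t pauli k)) *m (V3 *t V4)].

(* The basis of n qubits is indexed by bit strings x : {ffun 'I_n -> 'I_2},
   numbered through enum_val. *)
Definition qubits_dim (n : nat) : nat := #|{: {ffun 'I_n -> 'I_2}}|.

Fact qubits_dimE n : qubits_dim n = (2 ^ n)%N.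
Proof. by rewrite /qubits_dim card_ffun !card_ord. Qed.

Definition bits n (a : 'I_(qubits_dim n)) : {ffun 'I_n -> 'I_2} := enum_val a.

(* U_AB, with the factors regrouped from A_1 B_1 ... A_n B_n into A (x) B:
   <a, b| U_AB |a', b'> = \prod_i <a_i, b_i| U_i |a'_i, b'_i>. *)
Definition tens_unitaries n (U : 'I_n -> 'M[C]_(2 * 2))
    : 'M[C]_(qubits_dim n * qubits_dim n) :=
  \matrix_(x, y)
    let: (a, b) := mxtens_unindex x in
    let: (a', b') := mxtens_unindex y in
    \prod_(i < n) U i (mxtens_index (bits a i, bits b i))
                      (mxtens_index (bits a' i, bits b' i)).

End Channels.

Arguments LO {R} dA dB.
Arguments LOCC {R} dA dB.

(* Main.v *)
From HB Require Import structures.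
Require Import Defs.
From mathcomp Require Import ring.

(* Write U = sum_k u_k F_k (x) G_k, where the F_k (and the G_k) are unitary and
   form an orthogonal basis of matrices, namely locally rotated Pauli strings.
   Since sum_k |u_k|^2 = 1, the claimed value is 2 (sum_k |u_k|)^2 - 1.

   Upper bound: with S X = F_k X F_l^* and T Y = G_k Y G_l^*, the cross terms
   (k, l) and (l, k) of rho |-> U rho U^* add up to |u_k u_l| times
     c S (x) T + conj, which is
     2 (P_c (x) Q_1 - P_{ic} (x) Q_i),
   where P_c = (c S + conj) / 2 and Q_c = (c T + conj) / 2 are signed local
   operations because of the polarization identity.

   Lower bound: let M = sum_k e_k F_k (x) G_k, with e_k the phase of u_k. On the
   Choi state of a map, the observable 2 |M><M| - 1 takes values in [-1, 1] on
   every product of completely positive maps: by Kraus decomposition,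
   Cauchy-Schwarz and Parseval, the overlap of M with a product K (x) L is at
   most the product of the norms of K and L. On the channel of U it takes the
   value 2 (sum_k |u_k|)^2 - 1. *)

Set Implicit Arguments.
Unset Strict Implicit.
Unset Printing Implicit Defensive.

Import Order.TTheory GRing.Theory Num.Theory.
Local Open Scope ring_scope.
Local Open Scope complex_scope.

(** * Kronecker products and adjoints of matrices *)

Section Matrices.
Local Open Scope sesquilinear_scope.
Context {C : numClosedFieldType}.

Lemma mxtens_index_bij m n : bijective (@mxtens_index m n).
Proof. by exists (@mxtens_unindex m n); [exact: mxtens_indexK | exact: mxtens_unindexK]. Qed.

Lemma sum_mxtens (V : nmodType) m n (f : 'I_(m * n) -> V) :
  \sum_k f k = \sum_i \sum_j f (mxtens_index (i, j)).
Proof.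
rewrite (reindex (@mxtens_index m n)); last exact/onW_bij/mxtens_index_bij.
by rewrite pair_big /=; apply: eq_bigr => -[].
Qed.

Lemma mxtens_index_eq m n (i i' : 'I_m) (j j' : 'I_n) :
  (mxtens_index (i, j) == mxtens_index (i', j')) = (i == i') && (j == j').
Proof. by rewrite (can_eq (@mxtens_indexK m n)) xpair_eqE. Qed.

Lemma tensmx_delta m n p q (i : 'I_m) (j : 'I_n) (k : 'I_p) (l : 'I_q) :
  delta_mx i j *t delta_mx k l =
  delta_mx (mxtens_index (i, k)) (mxtens_index (j, l)) :> 'M[C]__.
Proof.
apply/matrixP => x y.
case: (mxtens_indexP x) => x1 x2; case: (mxtens_indexP y) => y1 y2.
by rewrite tensmxE !mxE !mxtens_index_eq -natrM mulnb andbACA.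
Qed.

Lemma tensmxDl m n p q (A B : 'M[C]_(m, n)) (D : 'M[C]_(p, q)) :
  (A + B) *t D = A *t D + B *t D.
Proof. by apply/matrixP => i j; rewrite !mxE mulrDl. Qed.

Lemma tensmxDr m n p q (A : 'M[C]_(m, n)) (B D : 'M[C]_(p, q)) :
  A *t (B + D) = A *t B + A *t D.
Proof. by apply/matrixP => i j; rewrite !mxE mulrDr. Qed.

Lemma tensmxZl m n p q a (A : 'M[C]_(m, n)) (D : 'M[C]_(p, q)) :
  (a *: A) *t D = a *: (A *t D).
Proof. by apply/matrixP => i j; rewrite !mxE mulrA. Qed.

Lemma tensmxZr m n p q a (A : 'M[C]_(m, n)) (D : 'M[C]_(p, q)) :
  A *t (a *: D) = a *: (A *t D).
Proof. by apply/matrixP => i j; rewrite !mxE mulrCA. Qed.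

Lemma tensmx_suml m n p q I r (P : pred I) (A : I -> 'M[C]_(m, n)) (D : 'M[C]_(p, q)) :
  (\sum_(i <- r | P i) A i) *t D = \sum_(i <- r | P i) (A i *t D).
Proof.
by apply: (big_morph (fun A => A *t D)) => [A' B'|]; rewrite ?tensmxDl ?tens0mx.
Qed.

Lemma tensmx_sumr m n p q I r (P : pred I) (A : 'M[C]_(m, n)) (D : I -> 'M[C]_(p, q)) :
  A *t (\sum_(i <- r | P i) D i) = \sum_(i <- r | P i) (A *t D i).
Proof.
by apply: (big_morph (fun D => A *t D)) => [A' B'|]; rewrite ?tensmxDr ?tensmx0.
Qed.

Lemma adjmxM m n p (A : 'M[C]_(m, n)) (B : 'M[C]_(n, p)) :
  (A *m B)^t* = B^t* *m A^t*.
Proof. by rewrite trmx_mul map_mxM. Qed.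

Lemma adjmx_tens m n p q (A : 'M[C]_(m, n)) (B : 'M[C]_(p, q)) :
  (A *t B)^t* = A^t* *t B^t*.
Proof. by rewrite trmx_tens map_mxT. Qed.

Lemma adjmxZ m n a (A : 'M[C]_(m, n)) : (a *: A)^t* = a^* *: A^t*.
Proof. by apply/matrixP => i j; rewrite !mxE rmorphM. Qed.

Lemma adjmxD m n (A B : 'M[C]_(m, n)) : (A + B)^t* = A^t* + B^t*.
Proof. by apply/matrixP => i j; rewrite !mxE rmorphD. Qed.

Lemma adjmx_sum m n I r (P : pred I) (A : I -> 'M[C]_(m, n)) :
  (\sum_(i <- r | P i) A i)^t* = \sum_(i <- r | P i) (A i)^t*.
Proof.
by apply: (big_morph (fun A : 'M_(m, n) => A^t*)) => [A' B'|];
  rewrite ?adjmxD ?trmx0 ?map_mx0.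
Qed.

Lemma adjmx1 n : (1%:M : 'M[C]_n)^t* = 1%:M.
Proof. by rewrite trmx1 map_mx1. Qed.

End Matrices.

(** * Tensor products of superoperators, Kraus terms and complete positivity *)

Section Superoperators.
Local Open Scope sesquilinear_scope.
Context {R : realType}.
Local Notation C := R[i].

Lemma tens_superopE m n p q (E : superop R m p) (F : superop R n q) X :
  tens_superop E F X = tens_superop_fun E F X.
Proof. by rewrite /tens_superop lfunE. Qed.

Lemma tens_superop_tens m n p q (E : superop R m p) (F : superop R n q) X Y :
  tens_superop E F (X *t Y) = E X *t F Y.
Proof.
rewrite tens_superopE /tens_superop_fun.
rewrite [in RHS](matrix_sum_delta X) [in RHS](matrix_sum_delta Y).
rewrite !linear_sum tensmx_suml; apply: eq_bigr => i _.
rewrite !linear_sum tensmx_suml; apply: eq_bigr => j _.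
rewrite tensmx_sumr; apply: eq_bigr => k _.
rewrite !linear_sum tensmx_sumr; apply: eq_bigr => l _.
by rewrite tensmxE !linearZ /= tensmxZl tensmxZr scalerA.
Qed.

Lemma superop_ext d d' (E F : superop R d d') :
  (forall i j, E (delta_mx i j) = F (delta_mx i j)) -> E = F.
Proof.
move=> EF; apply/lfunP => X; rewrite (matrix_sum_delta X) !linear_sum.
apply: eq_bigr => i _; rewrite !linear_sum; apply: eq_bigr => j _.
by rewrite !linearZ /= EF.
Qed.

(** Matrix units of the composite are products of matrix units. The algebra of [tens_superop] below
    is reduced to [tens_superop_tens] through this. *)
Lemma superop_tens_ext m n d' (E F : superop R (m * n) d') :
  (forall X Y, E (X *t Y) = F (X *t Y)) -> E = F.
Proof.
move=> EF; apply: superop_ext => x y.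
case: (mxtens_indexP x) => i k; case: (mxtens_indexP y) => j l.
by rewrite -tensmx_delta.
Qed.

Lemma tens_superop_comp m n p q r s (E : superop R m p) (F : superop R n q)
    (E' : superop R p r) (F' : superop R q s) :
  tens_superop (E' \o E)%VF (F' \o F)%VF
  = (tens_superop E' F' \o tens_superop E F)%VF.
Proof.
apply: superop_tens_ext => X Y.
by rewrite comp_lfunE 3!tens_superop_tens 2!comp_lfunE.
Qed.

Lemma tens_superop1 m n :
  tens_superop (\1%VF : superop R m m) (\1%VF : superop R n n) = \1%VF.
Proof. by apply: superop_tens_ext => X Y; rewrite tens_superop_tens 3!id_lfunE. Qed.

Lemma tens_superopDl m n p q (E E' : superop R m p) (F : superop R n q) :
  tens_superop (E + E') F = tens_superop E F + tens_superop E' F.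
Proof.
apply: superop_tens_ext => X Y.
by rewrite (tens_superop_tens (E + E') F) add_lfunE [RHS]add_lfunE
  (tens_superop_tens E F) (tens_superop_tens E' F) tensmxDl.
Qed.

Lemma tens_superopDr m n p q (E : superop R m p) (F F' : superop R n q) :
  tens_superop E (F + F') = tens_superop E F + tens_superop E F'.
Proof.
apply: superop_tens_ext => X Y.
by rewrite (tens_superop_tens E (F + F')) add_lfunE [RHS]add_lfunE
  (tens_superop_tens E F) (tens_superop_tens E F') tensmxDr.
Qed.

Lemma tens_superopZl m n p q a (E : superop R m p) (F : superop R n q) :
  tens_superop (a *: E) F = a *: tens_superop E F.
Proof.
apply: superop_tens_ext => X Y.
by rewrite (tens_superop_tens (a *: E) F) scale_lfunE [RHS]scale_lfunE
  (tens_superop_tens E F) tensmxZl.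
Qed.

Lemma tens_superopZr m n p q a (E : superop R m p) (F : superop R n q) :
  tens_superop E (a *: F) = a *: tens_superop E F.
Proof.
apply: superop_tens_ext => X Y.
by rewrite (tens_superop_tens E (a *: F)) scale_lfunE [RHS]scale_lfunE
  (tens_superop_tens E F) tensmxZr.
Qed.

Lemma tens_superopBl m n p q (E E' : superop R m p) (F : superop R n q) :
  tens_superop (E - E') F = tens_superop E F - tens_superop E' F.
Proof. by rewrite tens_superopDl -[- E']scaleN1r tens_superopZl scaleN1r. Qed.

Lemma tens_superopBr m n p q (E : superop R m p) (F F' : superop R n q) :
  tens_superop E (F - F') = tens_superop E F - tens_superop E F'.
Proof. by rewrite tens_superopDr -[- F']scaleN1r tens_superopZr scaleN1r. Qed.

Lemma tens_superop_suml m n p q I r (P : pred I) (E : I -> superop R m p)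
    (F : superop R n q) :
  tens_superop (\sum_(i <- r | P i) E i) F = \sum_(i <- r | P i) tens_superop (E i) F.
Proof.
apply: (big_morph (fun E => tens_superop E F)) => [E1 E2|]; first exact: tens_superopDl.
by rewrite -(scale0r 0) tens_superopZl scale0r.
Qed.

Lemma tens_superop_sumr m n p q I r (P : pred I) (E : superop R m p)
    (F : I -> superop R n q) :
  tens_superop E (\sum_(i <- r | P i) F i) = \sum_(i <- r | P i) tens_superop E (F i).
Proof.
apply: (big_morph (fun F => tens_superop E F)) => [E1 E2|]; first exact: tens_superopDr.
by rewrite -(scale0r 0) tens_superopZr scale0r.
Qed.

Section Sandwich.
Context {m n : nat} (A B : 'M[C]_(n, m)).

(** For [A = B] this is a single Kraus term. Distinct [A] and [B] occur as cross terms when the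
    channel of a linear combination of matrices is expanded. *)
Definition sandwich_fun (X : 'M[C]_m) : 'M[C]_n := A *m X *m B^t*.

Fact sandwich_fun_is_linear : linear sandwich_fun.
Proof.
by move=> a X Y; rewrite /sandwich_fun mulmxDr mulmxDl -scalemxAr -scalemxAl.
Qed.

HB.instance Definition _ :=
  GRing.isLinear.Build C 'M[C]_m 'M[C]_n _ sandwich_fun sandwich_fun_is_linear.

Definition sandwich : superop R m n := linfun sandwich_fun.

Lemma sandwichE X : sandwich X = A *m X *m B^t*.
Proof. by rewrite /sandwich lfunE. Qed.

End Sandwich.

Lemma unitary_channel_sandwich d (U : 'M[C]_d) : unitary_channel U = sandwich U U.
Proof. by []. Qed.

Lemma sandwichDl m n (A A' B : 'M[C]_(n, m)) :
  sandwich (A + A') B = sandwich A B + sandwich A' B.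
Proof. by apply/lfunP => X; rewrite add_lfunE !sandwichE !mulmxDl. Qed.

Lemma sandwichDr m n (A B B' : 'M[C]_(n, m)) :
  sandwich A (B + B') = sandwich A B + sandwich A B'.
Proof. by apply/lfunP => X; rewrite add_lfunE !sandwichE adjmxD mulmxDr. Qed.

Lemma sandwichZl m n a (A B : 'M[C]_(n, m)) :
  sandwich (a *: A) B = a *: sandwich A B.
Proof. by apply/lfunP => X; rewrite scale_lfunE !sandwichE -!scalemxAl. Qed.

Lemma sandwichZr m n a (A B : 'M[C]_(n, m)) :
  sandwich A (a *: B) = a^* *: sandwich A B.
Proof. by apply/lfunP => X; rewrite scale_lfunE !sandwichE adjmxZ -scalemxAr. Qed.

Lemma sandwich_suml m n I r (P : pred I) (A : I -> 'M[C]_(n, m)) B :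
  sandwich (\sum_(i <- r | P i) A i) B = \sum_(i <- r | P i) sandwich (A i) B.
Proof.
apply: (big_morph (fun A => sandwich A B)) => [E1 E2|]; first exact: sandwichDl.
by rewrite -(scale0r 0) sandwichZl scale0r.
Qed.

Lemma sandwich_sumr m n I r (P : pred I) A (B : I -> 'M[C]_(n, m)) :
  sandwich A (\sum_(i <- r | P i) B i) = \sum_(i <- r | P i) sandwich A (B i).
Proof.
apply: (big_morph (fun B => sandwich A B)) => [E1 E2|]; first exact: sandwichDr.
by rewrite -(scale0r 0) sandwichZr rmorph0 scale0r.
Qed.

Lemma tens_sandwich m n p q (A B : 'M[C]_(n, m)) (A' B' : 'M[C]_(q, p)) :
  tens_superop (sandwich A B) (sandwich A' B') = sandwich (A *t A') (B *t B').
Proof.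
apply: superop_tens_ext => X Y.
by rewrite tens_superop_tens sandwichE sandwichE sandwichE adjmx_tens !tensmx_mul.
Qed.

Lemma sandwich1 d : sandwich 1%:M 1%:M = \1%VF :> superop R d d.
Proof. by apply/lfunP => X; rewrite sandwichE id_lfunE adjmx1 mulmx1 mul1mx. Qed.

Lemma psdD d (X Y : 'M[C]_d) : psd X -> psd Y -> psd (X + Y).
Proof. by move=> hX hY v; rewrite mulmxDr mulmxDl mxE addr_ge0. Qed.

Lemma psdZ d a (X : 'M[C]_d) : 0 <= a -> psd X -> psd (a *: X).
Proof. by move=> ha hX v; rewrite -scalemxAr -scalemxAl mxE mulr_ge0. Qed.

Lemma psd_sandwich m n (A : 'M[C]_(n, m)) X : psd X -> psd (sandwich A A X).
Proof.
move=> hX v; rewrite sandwichE.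
by have := hX (A^t* *m v); rewrite adjmxM trmxCK !mulmxA.
Qed.

Lemma CP_id d : CP (\1%VF : superop R d d).
Proof. by move=> k X hX; rewrite tens_superop1 id_lfunE. Qed.

Lemma CP_comp m n p (E : superop R m n) (F : superop R n p) :
  CP E -> CP F -> CP (F \o E)%VF.
Proof.
move=> hE hF k X hX.
(* The identity on the ancilla is split as [\1 \o \1], so that the two maps act one after the
   other. *)
rewrite -[X in tens_superop X]comp_lfun1l tens_superop_comp comp_lfunE.
by apply: hF; apply: hE.
Qed.

Lemma CP_add m n (E F : superop R m n) : CP E -> CP F -> CP (E + F).
Proof.
move=> hE hF k X hX; rewrite tens_superopDr add_lfunE.
by apply: psdD; [apply: hE | apply: hF].
Qed.

Lemma CP_scale m n a (E : superop R m n) : 0 <= a -> CP E -> CP (a *: E).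
Proof.
move=> ha hE k X hX; rewrite tens_superopZr scale_lfunE.
by apply: psdZ => //; apply: hE.
Qed.

Lemma CP_sandwich m n (A : 'M[C]_(n, m)) : CP (sandwich A A).
Proof.
by move=> k X hX; rewrite -sandwich1 tens_sandwich; apply: psd_sandwich.
Qed.

Lemma CPTP_id d : CPTP (\1%VF : superop R d d).
Proof. by split; [exact: CP_id | move=> X; rewrite id_lfunE]. Qed.

End Superoperators.

(** * Positive semidefinite matrices, Cauchy-Schwarz, and orthogonal bases of unitaries *)

Section PositiveMatrices.
Local Open Scope sesquilinear_scope.
Context {C : numClosedFieldType}.

Lemma delta_form d (A : 'M[C]_d) i j :
  ((delta_mx i 0 : 'cV_d)^t* *m A *m (delta_mx j 0 : 'cV_d)) 0 0 = A i j.
Proof. by rewrite trmx_delta map_delta_mx -rowE -colE !mxE. Qed.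

(** Polarization: the form is real on [e_i + c e_j]. Taking [c = 1] and [c = 'i] shows that
    [A i j + A j i] and ['i (A i j - A j i)] are real, which together determine the conjugate of
    [A j i]. *)
Lemma form_ge0_hermitian d (A : 'M[C]_d) :
  (forall v : 'cV_d, 0 <= (v^t* *m A *m v) 0 0) -> A^t* = A.
Proof.
move=> hA; apply/matrixP => i j; rewrite !mxE.
have expand (x y : 'cV[C]_d) c : ((x + c *: y)^t* *m A *m (x + c *: y)) 0 0 =
    (x^t* *m A *m x) 0 0 + c * (x^t* *m A *m y) 0 0 +
    (c^* * (y^t* *m A *m x) 0 0 + c^* * c * (y^t* *m A *m y) 0 0).
  rewrite adjmxD adjmxZ !mulmxDl !mulmxDr -!scalemxAl -!scalemxAr scalerA.
  move: (x^t* *m A *m x) (x^t* *m A *m y) (y^t* *m A *m x) (y^t* *m A *m y).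
  by move=> X Y Z T; rewrite !mxE [c * _]mulrC.
have real_form (c : C) :
    A i i + c * A i j + (c^* * A j i + c^* * c * A j j) \is Num.real.
  apply: ger0_real; have := hA (delta_mx i 0 + c *: delta_mx j 0).
  by rewrite expand (delta_form A i i) (delta_form A i j) (delta_form A j i) (delta_form A j j).
have real_diag k : A k k \is Num.real.
  by apply: ger0_real; have := hA (delta_mx k 0); rewrite delta_form.
have conj_of_real (x : C) : x \is Num.real -> x^*%R = x by move/CrealP.
have e1 : A i j + A j i \is Num.real.
  have := real_form 1; rewrite rmorph1 !mul1r => h.
  have -> : A i j + A j i = A i i + A i j + (A j i + A j j) - A i i - A j j by ring.
  by rewrite !rpredB.
have e2 : 'i%R * (A i j - A j i) \is Num.real.
  have iN : - 'i%R * 'i%R = 1 :> C by rewrite mulNr -expr2 sqrCi opprK.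
  have := real_form 'i%R; rewrite conjCi iN mul1r => h.
  have -> : 'i%R * (A i j - A j i) =
      A i i + 'i%R * A i j + (- 'i%R * A j i + A j j) - A i i - A j j by ring.
  by rewrite !rpredB.
move/conj_of_real: e1; rewrite rmorphD /= => e1.
move/conj_of_real: e2; rewrite rmorphM rmorphB /= conjCi mulNr -mulrN.
move=> /(mulfI (neq0Ci _)) e2.
apply: (@mulfI _ 2%:R); first by rewrite pnatr_eq0.
have -> : 2%:R * (A j i)^* = (A i j)^* + (A j i)^* - ((A i j)^* - (A j i)^*) by ring.
by rewrite e1 -[_ - _ in LHS]opprK e2; ring.
Qed.

(** A Hermitian matrix is normal, so the spectral theorem applies; [B] scales the eigenvectors by
    the square roots of the eigenvalues. *)
Lemma form_ge0_factor d (A : 'M[C]_d) :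
  (forall v : 'cV_d, 0 <= (v^t* *m A *m v) 0 0) -> exists B : 'M[C]_d, A = B *m B^t*.
Proof.
move=> hA.
have /orthomx_spectralP : A \is normalmx.
  by apply/normalmxP; rewrite form_ge0_hermitian.
set P := spectralmx A; set D := spectral_diag A => defA.
have uP : P \is unitarymx by exact: spectral_unitarymx.
rewrite invmx_unitary // in defA.
(* An eigenvalue is the value of the form on its eigenvector, the adjoint of a row of [P]. *)
have D_ge0 i : 0 <= D 0 i.
  have := hA ((row i P)^t*); rewrite trmxCK defA.
  have -> : row i P *m (P^t* *m diag_mx D *m P) *m (row i P)^t* =
            row i (P *m P^t* *m diag_mx D *m (P *m P^t*)) *m delta_mx i 0.
    by rewrite tr_row map_col colE !row_mul !mulmxA.
  by rewrite (unitarymxP uP) mul1mx mulmx1 -colE !mxE eqxx mulr1n.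
exists (P^t* *m diag_mx (map_mx sqrtC D)).
rewrite trmx_mul map_mxM trmxCK defA !mulmxA; congr (_ *m _); rewrite -!mulmxA; congr (_ *m _).
apply/matrixP => i j; rewrite mul_diag_mx !mxE.
case: eqVneq => [->|]; last by rewrite !mulr0n rmorph0 mulr0.
by rewrite !mulr1n /= (CrealP _) ?ger0_real ?sqrtC_ge0 // -expr2 sqrtCK.
Qed.

Lemma mul_delta_mx_mulE m n p q (X : 'M[C]_(m, n)) i j (Y : 'M[C]_(p, q)) k l :
  (X *m delta_mx i j *m Y) k l = X k i * Y j l.
Proof.
have -> : delta_mx i j = delta_mx i (0 : 'I_1) *m delta_mx 0 j :> 'M[C]__.
  by rewrite mul_delta_mx.
by rewrite mulmxA -colE -mulmxA -rowE mxE big_ord1 !mxE.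
Qed.

(** Lagrange's identity: twice the difference of the two sides is a sum of squared moduli over
    ordered pairs. *)
Lemma cauchy_schwarz_sum (I : finType) (x y : I -> C) :
  `|\sum_k x k * y k| ^+ 2 <= (\sum_k `|x k| ^+ 2) * (\sum_k `|y k| ^+ 2).
Proof.
suff lagrange : \sum_k \sum_l `|x k * (y l)^* - x l * (y k)^*| ^+ 2 =
    2%:R * ((\sum_k `|x k| ^+ 2) * (\sum_k `|y k| ^+ 2) - `|\sum_k x k * y k| ^+ 2).
  rewrite -subr_ge0 -(pmulr_rge0 _ (ltr0Sn C 1)) -lagrange.
  by apply: sumr_ge0 => k _; apply: sumr_ge0 => l _; rewrite exprn_ge0.
(* Each square is a term plus its mirror image under exchange of [k] and [l], so both halves have
   the same double sum. *)
have expand k l : `|x k * (y l)^* - x l * (y k)^*| ^+ 2 =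
    (`|x k| ^+ 2 * `|y l| ^+ 2 - x k * y k * (x l * y l)^*)
    + (`|x l| ^+ 2 * `|y k| ^+ 2 - x l * y l * (x k * y k)^*).
  by rewrite !normCK !(rmorphB, rmorphM) /= !conjCK; ring.
have half : \sum_k \sum_l (`|x k| ^+ 2 * `|y l| ^+ 2 - x k * y k * (x l * y l)^*) =
    (\sum_k `|x k| ^+ 2) * (\sum_k `|y k| ^+ 2) - `|\sum_k x k * y k| ^+ 2.
  rewrite normCK rmorph_sum !big_distrlr /= -sumrB; apply: eq_bigr => k _.
  by rewrite -sumrB.
under eq_bigr do under eq_bigr do rewrite expand.
under eq_bigr do rewrite big_split.
rewrite big_split /= half [X in _ + X]exchange_big /= half.
by ring.
Qed.

Lemma mxtrace_mul m n (A : 'M[C]_(m, n)) (B : 'M[C]_(n, m)) :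
  \tr (A *m B) = \sum_i \sum_j A i j * B j i.
Proof. by apply: eq_bigr => i _; rewrite mxE. Qed.

Lemma mxtrace_tens m n (A : 'M[C]_m) (B : 'M[C]_n) : \tr (A *t B) = \tr A * \tr B.
Proof.
rewrite /mxtrace sum_mxtens big_distrlr /=; apply: eq_bigr => i _.
by apply: eq_bigr => j _; rewrite tensmxE.
Qed.

(** Orthogonality for the Hilbert-Schmidt product, with squared norm [d]. The last clause is the
    completeness relation in entries; stating it directly spares a count of [I] against [d ^ 2]. *)
Definition unitary_basis (I : finType) d (F : I -> 'M[C]_d) : Prop :=
  [/\ forall k, F k \is unitarymx,
      forall k l, \tr ((F k)^t* *m F l) = d%:R * (k == l)%:R
    & forall x y x' y',
        \sum_k F k x y * (F k x' y')^* = d%:R * ((x == x') && (y == y'))%:R].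

(** Squaring gives a double sum over entries of [X]; once the sum over [k] is moved inside,
    completeness kills every pair of distinct entries. *)
Lemma unitary_basis_parseval (I : finType) d (F : I -> 'M[C]_d) (X : 'M[C]_d) :
  unitary_basis F -> \sum_k `|\tr ((F k)^t* *m X)| ^+ 2 = d%:R * \tr (X *m X^t*).
Proof.
case=> _ _ complete.
have coeff k : `|\tr ((F k)^t* *m X)| ^+ 2 =
    \sum_p \sum_q X p.2 p.1 * (X q.2 q.1)^* * (F k q.2 q.1 * (F k p.2 p.1)^*).
  rewrite normCK mxtrace_mul pair_big rmorph_sum big_distrlr /=.
  apply: eq_bigr => p _; apply: eq_bigr => q _.
  by rewrite !mxE !rmorphM /= conjCK; ring.
under eq_bigr do rewrite coeff.
have -> : \tr (X *m X^t*) = \sum_p X p.2 p.1 * (X p.2 p.1)^*.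
  rewrite mxtrace_mul exchange_big pair_big /=.
  by apply: eq_bigr => p _; rewrite !mxE.
rewrite exchange_big mulr_sumr /=.
apply: eq_bigr => p _; rewrite exchange_big (bigD1 p) //= [X in _ + X]big1 => [|q qp].
  by rewrite -mulr_sumr complete !eqxx mulr1 addr0 mulrC.
rewrite -mulr_sumr complete.
by move: qp; rewrite -pair_eqE /= andbC => /negPf ->; rewrite !mulr0.
Qed.

(** The trace factorizes term by term over [K] and [L]. The phases drop out after Cauchy-Schwarz,
    and Parseval evaluates the two remaining sums. *)
Lemma entangled_overlap (I : finType) d (F G : I -> 'M[C]_d) (e : I -> C) (K L : 'M[C]_d) :
  unitary_basis F -> unitary_basis G -> (forall k, `|e k| = 1) ->
  `|\tr ((\sum_k e k *: (F k *t G k))^t* *m (K *t L))| ^+ 2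
    <= d%:R ^+ 2 * (\tr (K *m K^t*) * \tr (L *m L^t*)).
Proof.
move=> hF hG he.
have -> : \tr ((\sum_k e k *: (F k *t G k))^t* *m (K *t L)) =
    \sum_k ((e k)^* * \tr ((F k)^t* *m K)) * \tr ((G k)^t* *m L).
  rewrite adjmx_sum mulmx_suml linear_sum; apply: eq_bigr => k _.
  by rewrite adjmxZ adjmx_tens -scalemxAl tensmx_mul /= mxtraceZ mxtrace_tens mulrA.
apply: le_trans (cauchy_schwarz_sum _ _) _.
under eq_bigr do rewrite normrM norm_conjC he mul1r.
by rewrite (unitary_basis_parseval _ hF) (unitary_basis_parseval _ hG) mulrACA.
Qed.

End PositiveMatrices.

(** * Kraus decomposition of completely positive maps *)

Section Kraus.
Local Open Scope sesquilinear_scope.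
Context {R : realType}.
Local Notation C := R[i].

(** Choi's argument: [E] applied to half of the unnormalized maximally entangled projector [Omega]
    is positive, hence of the form [B *m B^t*]. The columns of [B], reshaped to matrices, are the
    Kraus operators. *)
Theorem CP_Kraus d d' (E : superop R d d') : CP E ->
  exists K : 'I_(d * d') -> 'M[C]_(d', d), E = \sum_m sandwich (K m) (K m).
Proof.
move=> hE; pose Omega : 'M[C]_(d * d) := \sum_i \sum_j delta_mx i j *t delta_mx i j.
have psd_Omega : psd Omega.
  pose w : 'cV[C]_(d * d) := \sum_i (delta_mx (mxtens_index (i, i)) 0).
  have -> : Omega = w *m w^t*.
    rewrite /w adjmx_sum mulmx_suml; apply: eq_bigr => i _.
    rewrite mulmx_sumr; apply: eq_bigr => j _.
    by rewrite trmx_delta map_delta_mx mul_delta_mx tensmx_delta.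
  move=> v; rewrite mulmxA -mulmxA -[X in X *m _ ]trmxCK adjmxM trmxCK.
  by rewrite mxE big_ord1 !mxE mulrC mul_conjC_ge0.
have [B defB] := form_ge0_factor (hE d Omega psd_Omega).
exists (fun m => \matrix_(x, i) B (mxtens_index (i, x)) m).
apply: superop_ext => i j; apply/matrixP => x y.
(* The block [(i, j)] of the Choi matrix is the image of the matrix unit [(i, j)]. *)
have -> : E (delta_mx i j) x y =
    tens_superop \1%VF E Omega (mxtens_index (i, x)) (mxtens_index (j, y)).
  rewrite /Omega linear_sum summxE (bigD1 i) //= [X in _ = _ + X]big1 => [|a /negPf ai].
    rewrite addr0 linear_sum summxE (bigD1 j) //= [X in _ = _ + X]big1 => [|b /negPf bj].
      by rewrite tens_superop_tens tensmxE id_lfunE !mxE !eqxx mul1r addr0.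
    by rewrite tens_superop_tens tensmxE id_lfunE !mxE [j == b]eq_sym bj andbF mul0r.
  rewrite linear_sum summxE big1 // => b _.
  by rewrite /= tens_superop_tens tensmxE id_lfunE !mxE [i == a]eq_sym ai mul0r.
rewrite defB mxE sum_lfunE summxE; apply: eq_bigr => m _.
by rewrite sandwichE mul_delta_mx_mulE !mxE.
Qed.

End Kraus.

(** * Lower bound: a linear witness that is bounded on LOCC maps *)

Section Witness.
Local Open Scope sesquilinear_scope.
Context {R : realType}.
Local Notation C := R[i].

(** This is the quadratic form of the unnormalized Choi matrix of [E] at the vectorization of
    [M]. *)
Definition overlap d (M : 'M[C]_d) (E : superop R d d) : C :=
  \sum_i \sum_j (M^t* *m E (delta_mx i j) *m M) i j.

Lemma overlap_sum d (M : 'M[C]_d) I r (P : pred I) (a : I -> C) (E : I -> superop R d d) :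
  overlap M (\sum_(m <- r | P m) a m *: E m) = \sum_(m <- r | P m) a m * overlap M (E m).
Proof.
rewrite /overlap; under [RHS]eq_bigr do rewrite mulr_sumr.
rewrite [RHS]exchange_big; apply: eq_bigr => i _.
under [RHS]eq_bigr do rewrite mulr_sumr.
rewrite [RHS]exchange_big; apply: eq_bigr => j _.
rewrite sum_lfunE mulmx_sumr mulmx_suml summxE; apply: eq_bigr => m _.
by rewrite scale_lfunE -scalemxAr -scalemxAl mxE.
Qed.

(** The Choi matrix of a single Kraus term has rank one, spanned by the vectorization of [K], so the
    form is a squared inner product. *)
Lemma overlap_sandwich d (M K : 'M[C]_d) :
  overlap M (sandwich K K) = `|\tr (M^t* *m K)| ^+ 2.
Proof.
have conj_tr : (\tr (M^t* *m K))^*%R = \tr (K^t* *m M).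
  by rewrite -[X in _ = \tr X]trmxCK adjmxM trmxCK /mxtrace rmorph_sum;
     apply: eq_bigr => i _; rewrite !mxE.
rewrite normCK conj_tr big_distrlr /=; apply: eq_bigr => i _; apply: eq_bigr => j _.
by rewrite sandwichE !mulmxA -[_ *m K^t* *m M]mulmxA mul_delta_mx_mulE.
Qed.

Section Bounds.
Context {I : finType} {d : nat} (F G : I -> 'M[C]_d) (e : I -> C).
Hypotheses (hF : unitary_basis F) (hG : unitary_basis G) (he : forall k, `|e k| = 1).
Local Notation M := (\sum_k e k *: (F k *t G k)).

(** All sides are additive over Kraus terms. For [K m *t L n] the trace of the image of the identity
    is the product of squared norms that bounds the overlap in [entangled_overlap]. *)
Lemma overlap_tens_bounds (P Q : superop R d d) : CP P -> CP Q ->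
  0 <= overlap M (tens_superop P Q)
    <= d%:R ^+ 2 * \tr (tens_superop P Q 1%:M).
Proof.
move=> /CP_Kraus [K ->] /CP_Kraus [L ->].
(* The unit scalars put both sums in the shape that [overlap_sum] expects. *)
have -> : tens_superop (\sum_m sandwich (K m) (K m)) (\sum_n sandwich (L n) (L n)) =
    \sum_m 1 *: \sum_n 1 *: sandwich (K m *t L n) (K m *t L n).
  rewrite tens_superop_suml; apply: eq_bigr => m _.
  rewrite scale1r tens_superop_sumr; apply: eq_bigr => n _.
  by rewrite scale1r tens_sandwich.
rewrite overlap_sum sum_lfunE linear_sum mulr_sumr; apply/andP; split.
  apply: sumr_ge0 => m _; rewrite mul1r overlap_sum; apply: sumr_ge0 => n _.
  by rewrite mul1r overlap_sandwich exprn_ge0.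
apply: ler_sum => m _; rewrite mul1r overlap_sum scale1r sum_lfunE linear_sum mulr_sumr.
apply: ler_sum => n _; rewrite mul1r overlap_sandwich scale1r sandwichE mulmx1.
by rewrite adjmx_tens tensmx_mul /= mxtrace_tens entangled_overlap.
Qed.

End Bounds.

(** Under the trace, a channel that depends on the other party's outcome can be erased, after which
    the outcomes can be summed. *)
Lemma tens_superop_trl m n p q (E : superop R m p) (T : superop R n q) X :
  TP T -> \tr (tens_superop E T X) = \tr (tens_superop E \1%VF X).
Proof.
move=> tpT; rewrite (matrix_sum_delta X) !linear_sum /=; apply: eq_bigr => x _.
rewrite !linear_sum /=; apply: eq_bigr => y _; rewrite !linearZ /=; congr (_ * _).
case: (mxtens_indexP x) => i k; case: (mxtens_indexP y) => j l.
by rewrite -tensmx_delta (tens_superop_tens E T) (tens_superop_tens E \1%VF) !mxtrace_tens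
  tpT id_lfunE.
Qed.

Lemma tens_superop_trr m n p q (T : superop R m p) (E : superop R n q) X :
  TP T -> \tr (tens_superop T E X) = \tr (tens_superop \1%VF E X).
Proof.
move=> tpT; rewrite (matrix_sum_delta X) !linear_sum /=; apply: eq_bigr => x _.
rewrite !linear_sum /=; apply: eq_bigr => y _; rewrite !linearZ /=; congr (_ * _).
case: (mxtens_indexP x) => i k; case: (mxtens_indexP y) => j l.
by rewrite -tensmx_delta (tens_superop_tens T E) (tens_superop_tens \1%VF E) !mxtrace_tens
  tpT id_lfunE.
Qed.

(** These two facts are what the lower bound extracts from LOCC. By induction on the protocol tree,
    a history composes products of completely positive maps, and each round preserves the total
    trace. *)
Lemma locc_rounds_product dA' dB' dA dB (I : finType)
    (G : I -> superop R (dA * dB) (dA' * dB')) : locc_rounds G ->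
  (forall h, exists (P : superop R dA dA') (Q : superop R dB dB'),
     [/\ CP P, CP Q & G h = tens_superop P Q]) /\
  (forall X, \sum_h \tr (G h X) = \tr X).
Proof.
elim=> {dA dB I G} [|dA dB dA1 dB1 I K E G round _ IH].
  split=> [_|X]; last by rewrite (big_pred1 tt) ?id_lfunE // => -[].
  by exists \1%VF, \1%VF; split; [exact: CP_id|exact: CP_id|rewrite (tens_superop1 dA' dB')].
have [prodE trE] : (forall h, exists (P : superop R dA dA1) (Q : superop R dB dB1),
     [/\ CP P, CP Q & E h = tens_superop P Q]) /\
  (forall X, \sum_h \tr (E h X) = \tr X).
  case: round => [[EA [TB [[cpEA tpEA] cptpTB defE]]]|[TA [EB [cptpTA [cpEB tpEB] defE]]]].
    split=> [h|X].
      by exists (EA h), (TB h); split=> //; case: (cptpTB h).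
    (* With the channels of the other party replaced by the identity, the sum moves inside onto the
       instrument, which preserves the trace. *)
    under eq_bigr do rewrite defE (tens_superop_trl _ _ (cptpTB _).2).
    rewrite -linear_sum /= -sum_lfunE -tens_superop_suml (tens_superop_trr _ _ tpEA).
    by rewrite (tens_superop1 dA dB) id_lfunE.
  split=> [h|X].
    by exists (TA h), (EB h); split=> //; case: (cptpTA h).
  under eq_bigr do rewrite defE (tens_superop_trr _ _ (cptpTA _).2).
  rewrite -linear_sum /= -sum_lfunE -tens_superop_sumr (tens_superop_trl _ _ tpEB).
  by rewrite (tens_superop1 dA dB) id_lfunE.
split=> [[i k]|X].
  have [P [Q [cpP cpQ defE]]] := prodE i.
  have [P' [Q' [cpP' cpQ' defG]]] := (IH i).1 k.
  exists (P' \o P)%VF, (Q' \o Q)%VF; rewrite tens_superop_comp /= defE defG.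
  by split=> //; exact: CP_comp.
(* Histories are grouped by the outcome of the first round. *)
rewrite -trE; transitivity (\sum_i \sum_(k : K i) \tr (G i k (E i X))); last first.
  by apply: eq_bigr => i _; rewrite (IH i).2.
rewrite (sig_big_dep xpredT (fun _ _ => true) (fun i k => \tr (G i k (E i X)))).
by apply: eq_bigr => -[i k] _; rewrite comp_lfunE.
Qed.

(** This is [d ^ 4] times the expectation of [2 |m><m| - 1] in the Choi state of [E], where [m] is
    the vectorization of [M] divided by [d]. The trace of the Choi matrix is the trace of
    [E 1%:M]. *)
Definition witness d (M : 'M[C]_(d * d)) (E : superop R (d * d) (d * d)) : C :=
  2%:R * overlap M E - d%:R ^+ 2 * \tr (E 1%:M).

Lemma witness_sum d (M : 'M[C]_(d * d)) I r (P : pred I) (a : I -> C)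
    (E : I -> superop R (d * d) (d * d)) :
  witness M (\sum_(m <- r | P m) a m *: E m) = \sum_(m <- r | P m) a m * witness M (E m).
Proof.
rewrite /witness overlap_sum sum_lfunE linear_sum !mulr_sumr -sumrB /=.
by apply: eq_bigr => m _; rewrite scale_lfunE mxtraceZ; ring.
Qed.

Section LowerBound.
Context {I : finType} {d : nat} (F G : I -> 'M[C]_d) (e : I -> C).
Hypotheses (hF : unitary_basis F) (hG : unitary_basis G) (he : forall k, `|e k| = 1).
Local Notation M := (\sum_k e k *: (F k *t G k)).

(** For each history, [0 <= x <= y] gives [|2 x - y| <= y], and by trace preservation the bounds [y]
    add up to [d ^ 4]. *)
Lemma witness_LOCC E : LOCC d d E -> `|witness M E| <= d%:R ^+ 4.
Proof.
case=> J [E' [s [[H [T [f [/locc_rounds_product [prodT trT] defE']]]] ->]]].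
(* Coarse-graining is undone: every history inherits the sign of its coarse outcome. *)
have -> : \sum_i (-1) ^+ s i *: E' i = \sum_h (-1) ^+ s (f h) *: T h.
  rewrite [RHS](partition_big f xpredT) //=; apply: eq_bigr => j _.
  by rewrite defE' scaler_sumr; apply: eq_bigr => h /eqP ->.
rewrite witness_sum (le_trans (ler_norm_sum _ _ _)) //.
have -> : d%:R ^+ 4 = \sum_h d%:R ^+ 2 * \tr (T h 1%:M) :> C.
  by rewrite -mulr_sumr trT mxtrace1 natrM; ring.
apply: ler_sum => h _; rewrite normrM normr_sign mul1r.
have [P [Q [cpP cpQ ->]]] := prodT h.
have /andP[ge0 le1] := overlap_tens_bounds hF hG he cpP cpQ.
rewrite /witness; set x := overlap _ _ in ge0 le1 *; set y := d%:R ^+ 2 * _ in le1 *.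
have real_x : x \is Num.real by rewrite ger0_real.
have real_y : y \is Num.real by rewrite ger0_real // (le_trans ge0).
have real_w : 2%:R * x - y \is Num.real by rewrite rpredB // rpredM // realn.
rewrite (real_ler_norml _ real_w).
rewrite lerBlDr -mulr2n -[y *+ 2]mulr_natl ler_pM2l ?ltr0n // le1 andbT.
by rewrite lerBrDl subrr mulr_ge0 ?ler0n.
Qed.

End LowerBound.

Lemma trace_unitary_basis_comb (I : finType) d (F G : I -> 'M[C]_d) (v u : I -> C) :
  unitary_basis F -> unitary_basis G ->
  \tr ((\sum_k v k *: (F k *t G k))^t* *m \sum_k u k *: (F k *t G k))
    = d%:R ^+ 2 * \sum_k (v k)^* * u k.
Proof.
case=> _ orthF _ [_ orthG _]; rewrite adjmx_sum mulmx_suml linear_sum mulr_sumr.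
apply: eq_bigr => k _; rewrite adjmxZ adjmx_tens mulmx_sumr linear_sum (bigD1 k) //=.
rewrite big1 => [|l lk]; rewrite -scalemxAl -scalemxAr scalerA mxtraceZ tensmx_mul
  mxtrace_tens orthF.
  by rewrite orthG eqxx !mulr1; ring.
by rewrite eq_sym (negPf lk) mulr0 mul0r mulr0.
Qed.

(** The value [1] at [0] keeps the modulus equal to [1] everywhere, as the witness bounds
    require. *)
Definition phase (x : C) : C := if x == 0 then 1 else x / `|x|.

Lemma norm_phase x : `|phase x| = 1.
Proof.
rewrite /phase; case: eqP => [_|/eqP nz]; first by rewrite normr1.
by rewrite normrM normfV normr_id divff ?normr_eq0.
Qed.

Lemma normMphase x : x = `|x| * phase x.
Proof.
rewrite /phase; case: eqP => [->|/eqP nz]; first by rewrite normr0 mul0r.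
by rewrite mulrC divfK ?normr_eq0.
Qed.

(** Duality: the witness is linear and at most [d ^ 4] in modulus on LOCC maps, so its value on the
    channel, divided by [d ^ 4], bounds the cost of any decomposition from below. *)
Lemma LOCC_cost_ge (I : finType) d (F G : I -> 'M[C]_d) (u : I -> C) (c : R) :
  (0 < d)%N -> unitary_basis F -> unitary_basis G -> \sum_k `|u k| ^+ 2 = 1 ->
  decomposition_costs (LOCC d d) (unitary_channel (\sum_k u k *: (F k *t G k))) c ->
  2%:R * (\sum_k `|u k|) ^+ 2 - 1 <= c%:C.
Proof.
move=> d_gt0 hF hG sum_u2 [m [a [E [_ locE defU ->]]]].
pose e k := phase (u k).
have he k : `|e k| = 1 := norm_phase (u k).
pose M := \sum_k e k *: (F k *t G k).
have witnessU : witness M (unitary_channel (\sum_k u k *: (F k *t G k))) =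
    d%:R ^+ 4 * (2%:R * (\sum_k `|u k|) ^+ 2 - 1).
  rewrite unitary_channel_sandwich /witness overlap_sandwich sandwichE mulmx1.
  rewrite [X in _ - _ * X]mxtrace_mulC !trace_unitary_basis_comb //.
  (* Since [e] carries the phases of [u], all terms of the overlap add up constructively. *)
  have -> : \sum_k (e k)^* * u k = \sum_k `|u k|.
    by apply: eq_bigr => k _; rewrite [u k in LHS]normMphase mulrCA -normCKC he expr1n mulr1.
  (* Normalization turns the subtracted trace term into exactly [d ^ 4]. *)
  have -> : \sum_k (u k)^* * u k = 1.
    by rewrite -sum_u2; apply: eq_bigr => k _; rewrite normCKC.
  rewrite normrM exprMn normrX normr_nat.
  by rewrite [`|\sum_k _|]ger0_norm ?sumr_ge0 //; ring.
have d4_gt0 : 0 < d%:R ^+ 4 :> C by rewrite exprn_gt0 ?ltr0n.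
set U := \sum_k _ in defU witnessU.
have real_witnessU : witness M (unitary_channel U) \is Num.real.
  rewrite witnessU rpredM ?rpredX ?realn // rpredB ?rpred1 // rpredM ?realn //.
  by rewrite rpredX // rpred_sum // => k _; apply: normr_real.
rewrite -(ler_pM2l d4_gt0) -witnessU (le_trans (real_ler_norm real_witnessU)) //.
rewrite defU witness_sum (le_trans (ler_norm_sum _ _ _)) // rmorph_sum mulr_sumr.
apply: ler_sum => i _; rewrite normrM mulrC ler_pM //.
  exact: witness_LOCC.
by rewrite normc_def /= expr0n addr0 sqrtr_sqr.
Qed.

End Witness.

(** * Upper bound: decomposition into products of signed local operations *)

Lemma quarter_turn_cancel (K : numClosedFieldType) (V : lmodType K) (c : K) (p q r s : V) :
  2%:R^-1 *: (2%:R^-1 *: ((c * 1) *: p + (c * 1^*) *: q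
                          + ((c^* * 1) *: r + (c^* * 1^*) *: s)))
  - 2%:R^-1 *: (2%:R^-1 *: ((c * 'i%R * 'i%R) *: p + (c * 'i%R * 'i%R^*) *: q
      + (((c * 'i%R)^* * 'i%R) *: r + ((c * 'i%R)^* * 'i%R^*) *: s)))
  = 2%:R^-1 *: (c *: p + c^* *: s).
Proof.
(* Turning both factors by ['i] negates the coefficients of [p] and [s] and fixes those of the mixed
   terms [q] and [r]. The difference doubles the former and cancels the latter. *)
have i2 : 'i%R * 'i%R = -1 :> K by rewrite -expr2 sqrCi.
have e1 : c * 'i%R * 'i%R = - c by rewrite -mulrA i2 mulrN1.
have e2 : c * 'i%R * 'i%R^* = c by rewrite conjCi mulrN e1 opprK.
have e3 : (c * 'i%R)^* * 'i%R = c^*%R.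
  by rewrite rmorphM /= conjCi mulrN mulNr -mulrA i2 mulrN1 opprK.
have e4 : (c * 'i%R)^* * 'i%R^* = - c^* by rewrite [X in _ * X]conjCi mulrN e3.
rewrite e1 e2 e3 e4 rmorph1 !mulr1.
rewrite -!scalerBr !opprD addrACA (addrACA (c *: p)) (addrACA (c^* *: r)).
rewrite -!scalerBl !opprK !subrr !scale0r.
rewrite addr0 add0r; congr (_ *: _).
have half x (v : V) : 2%:R^-1 *: ((x + x) *: v) = x *: v.
  by rewrite scalerA; congr (_ *: _); field.
by rewrite scalerDr !half.
Qed.

(** Averaging each off-diagonal term with its transpose leaves the double sum unchanged and produces
    the Hermiticity-preserving combinations handled by [tens_cross_term]. *)
Lemma hermitian_double_sum (K : numClosedFieldType) (V : lmodType K) (I : finType)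
    (u e : I -> K) (p : I -> I -> V) : (forall k, u k = `|u k| * e k) ->
  \sum_k \sum_l (u k * (u l)^*) *: p k l =
  \sum_k `|u k| ^+ 2 *: p k k
  + \sum_k \sum_l (if k == l then 0 else `|u k| * `|u l|) *:
      (2%:R^-1 *: ((e k * (e l)^*) *: p k l + (e k * (e l)^*)^* *: p l k)).
Proof.
move=> defu; pose w k l := (u k * (u l)^*) *: p k l.
pose q k l := if k == l then 0 else w k l.
have -> : \sum_k \sum_l (if k == l then 0 else `|u k| * `|u l|) *:
      (2%:R^-1 *: ((e k * (e l)^*) *: p k l + (e k * (e l)^*)^* *: p l k)) =
    \sum_k \sum_l 2%:R^-1 *: (q k l + q l k).
  apply: eq_bigr => k _; apply: eq_bigr => l _; rewrite /q [l == k]eq_sym.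
  case: eqP => _; first by rewrite scale0r addr0 scaler0.
  rewrite scalerA [_ * 2%:R^-1]mulrC -[LHS]scalerA; congr (_ *: _).
  rewrite scalerDr !scalerA /w [u k in RHS]defu [u l in RHS]defu !rmorphM /= conjCK.
  by rewrite !conj_normC; congr (_ *: _ + _ *: _); ring.
have -> : \sum_k \sum_l 2%:R^-1 *: (q k l + q l k) = \sum_k \sum_l q k l.
  under eq_bigr do rewrite -scaler_sumr big_split.
  rewrite -scaler_sumr big_split /= [X in _ + X]exchange_big /=.
  by rewrite -mulr2n -scaler_nat scalerA mulVf ?scale1r ?pnatr_eq0.
rewrite -big_split; apply: eq_bigr => k _; rewrite (bigD1 k) //= -normCK; congr (_ + _).
rewrite [RHS](bigD1 k) //= /q eqxx add0r; apply: eq_bigr => l.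
by rewrite eq_sym => /negPf ->.
Qed.

Section UpperBound.
Local Open Scope sesquilinear_scope.
Context {R : realType}.
Local Notation C := R[i].

Lemma decomposition_costs_fin d d' (S : set (superop R d d')) E (T : finType)
    (a : T -> R) (F : T -> superop R d d') :
  (0 < #|T|)%N -> (forall t, S (F t)) -> E = \sum_t (a t)%:C *: F t ->
  decomposition_costs S E (\sum_t `|a t|).
Proof.
move=> T_gt0 SF defE; exists #|T|, (a \o enum_val), (F \o enum_val); split=> //.
- by move=> i; exact: SF.
- by rewrite defE (big_enum_val (fun t => (a t)%:C *: F t)).
- by rewrite (big_enum_val (fun t => `|a t|)).
Qed.

Lemma decomposition_costs_subset d d' (S S' : set (superop R d d')) E c :
  (forall F, S F -> S' F) -> decomposition_costs S E c -> decomposition_costs S' E c.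
Proof. by move=> SS' [m [a [F [m1 SF -> ->]]]]; exists m, a, F; split=> // i; exact: SS'. Qed.

(** The positive and negative parts of a signed local operation form a two-outcome instrument. Both
    parties apply theirs without using the other's outcome, and the sign is the product of the two
    local signs. *)
Lemma LO_LOCC dA dB (F : superop R (dA * dB) (dA * dB)) : LO dA dB F -> LOCC dA dB F.
Proof.
case=> FA [FB [[Ap [Am [cpAp cpAm [_ tpA] ->]]] [Bp [Bm [cpBp cpBm [_ tpB] ->]]] ->]].
pose EA b := if b then Ap else Am; pose EB b := if b then Bp else Bm.
pose K1 : finType := {_ : bool & unit}.
pose G1 (h : K1) : superop R (dA * dB) (dA * dB) :=
  (\1 \o tens_superop \1 (EB (tag h)))%VF.
have rounds1 : locc_rounds G1.
  apply: (LoccRound (E := fun b => tens_superop \1%VF (EB b))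
           (G := fun _ _ => \1%VF)) => [|_]; last exact: LoccDone.
  right; exists (fun _ => \1%VF), EB; split=> [_||b]; [exact: CPTP_id| |reflexivity].
  by split=> [[]|]; [exact: cpBp|exact: cpBm|rewrite big_bool].
pose G (h : {_ : bool & K1}) : superop R (dA * dB) (dA * dB) :=
  (G1 (tagged h) \o tens_superop (EA (tag h)) \1)%VF.
have rounds : locc_rounds G.
  apply: (LoccRound (E := fun b => tens_superop (EA b) \1%VF)
           (G := fun _ => G1)) => [|_]; last exact: rounds1.
  left; exists EA, (fun _ => \1%VF); split=> [|_|b]; [|exact: CPTP_id|reflexivity].
  by split=> [[]|]; [exact: cpAp|exact: cpAm|rewrite big_bool].
(* Outcome [false] stands for the negative part, and the exclusive or multiplies the signs. *)
exists {_ : bool & K1}, G, (fun h => ~~ tag h (+) ~~ tag (tagged h)); split.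
  exists {_ : bool & K1}, G, id; split=> // h.
  by rewrite (big_pred1 h).
have GE h : G h = tens_superop (EA (tag h)) (EB (tag (tagged h))).
  rewrite /G /G1 comp_lfun1l -(tens_superop_comp (EA (tag h)) \1%VF \1%VF).
  by rewrite comp_lfun1l comp_lfun1r.
transitivity (\sum_a \sum_b (-1) ^+ (~~ a (+) ~~ b) *: tens_superop (EA a) (EB b)).
  have -> (f : bool -> bool -> superop R (dA * dB) (dA * dB)) :
      \sum_a \sum_b (-1) ^+ (~~ a (+) ~~ b) *: f a b =
      f true true - f true false - (f false true - f false false).
    rewrite big_bool (big_bool _ (fun b => _ *: f true b)).
    rewrite (big_bool _ (fun b => _ *: f false b)) expr0 expr1.
    by rewrite !scale1r !scaleN1r opprB [f false false - _]addrC.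
  by rewrite (tens_superopBl Ap Am) (tens_superopBr Ap) (tens_superopBr Am).
under [RHS]eq_bigr do rewrite GE.
rewrite -(sig_big_dep xpredT (fun _ _ => true) (fun a (h : K1) =>
  (-1) ^+ (~~ a (+) ~~ tag h) *: tens_superop (EA a) (EB (tag h)))).
apply: eq_bigr => a _.
rewrite -(sig_big_dep xpredT (fun _ _ => true) (fun b (_ : unit) =>
  (-1) ^+ (~~ a (+) ~~ b) *: tens_superop (EA a) (EB b))).
by apply: eq_bigr => b _; rewrite (big_pred1 tt) // => -[].
Qed.

Lemma CPTP_mean_unitary d (A B : 'M[C]_d) : A \is unitarymx -> B \is unitarymx ->
  CPTP (2%:R^-1 *: (sandwich A A + sandwich B B)).
Proof.
move=> uA uB; split.
  by apply: CP_scale; [rewrite invr_ge0 ler0n|apply: CP_add; exact: CP_sandwich].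
have trU (V X : 'M[C]_d) : V \is unitarymx -> \tr (sandwich V V X) = \tr X.
  move=> uV; rewrite sandwichE mxtrace_mulC mulmxA -invmx_unitary //.
  by rewrite mulVmx ?mul1mx ?unitarymx_unit.
move=> X; rewrite scale_lfunE add_lfunE mxtraceZ mxtraceD !trU //.
by field.
Qed.

(** The Hermiticity-preserving part of [c *: sandwich A B], that is, the map [P_c] of the
    overview. *)
Definition cross_term d (A B : 'M[C]_d) (c : C) : superop R d d :=
  2%:R^-1 *: (c *: sandwich A B + c^* *: sandwich B A).

(** Polarization with [c *: A + B] and [c *: A - B]: a quarter of the difference of their Kraus
    terms is the cross term, and a quarter of the sum is the mean of two unitary channels. *)
Lemma signed_local_cross_term d (A B : 'M[C]_d) c :
  A \is unitarymx -> B \is unitarymx -> `|c| = 1 -> signed_local (cross_term A B c).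
Proof.
move=> uA uB c1.
have cc : c * c^* = 1 by rewrite -normCK c1 expr1n.
pose D : superop R d d := sandwich A A + sandwich B B.
pose O : superop R d d := c *: sandwich A B + c^* *: sandwich B A.
have defp : sandwich (c *: A + B) (c *: A + B) = D + O.
  rewrite sandwichDl !sandwichDr !sandwichZl !sandwichZr scalerA cc scale1r.
  by rewrite [_ *: sandwich B A + _]addrC addrACA.
have defm : sandwich (c *: A - B) (c *: A - B) = D - O.
  rewrite -[- B]scaleN1r sandwichDl !sandwichDr !sandwichZl !sandwichZr !scalerA cc scale1r.
  rewrite rmorphN1 /= mulrN1 2!mulN1r opprK scale1r 2!scaleNr.
  by rewrite [- _ + sandwich B B]addrC addrACA -opprD.
pose Fp : superop R d d := 4%:R^-1 *: (D + O).
pose Fm : superop R d d := 4%:R^-1 *: (D - O).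
have quarter (X : superop R d d) : 4%:R^-1 *: (X + X) = 2%:R^-1 *: X.
  by rewrite -[in X + X](scale1r X) -scalerDl scalerA; congr (_ *: _); field.
exists Fp, Fm; split.
- by rewrite /Fp -defp; apply: CP_scale; [rewrite invr_ge0 ler0n|exact: CP_sandwich].
- by rewrite /Fm -defm; apply: CP_scale; [rewrite invr_ge0 ler0n|exact: CP_sandwich].
- rewrite /Fp /Fm -scalerDr addrACA subrr addr0 quarter.
  exact: CPTP_mean_unitary.
- by rewrite /Fp /Fm -scalerBr opprB [O - D]addrC addrACA subrr add0r quarter.
Qed.

Lemma cross_term_diag d (A : 'M[C]_d) : cross_term A A 1 = sandwich A A.
Proof.
by rewrite /cross_term rmorph1 !scale1r -[in X in _ *: X](scale1r (sandwich A A))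
  -scalerDl scalerA mulVf ?scale1r ?pnatr_eq0.
Qed.

Lemma tens_superop_comb m n p q a a' b b' (E E' : superop R m p) (F F' : superop R n q) :
  tens_superop (a *: E + a' *: E') (b *: F + b' *: F') =
  (a * b) *: tens_superop E F + (a * b') *: tens_superop E F'
  + ((a' * b) *: tens_superop E' F + (a' * b') *: tens_superop E' F').
Proof.
rewrite (tens_superopDl (a *: E)) (tens_superopZl a E) (tens_superopZl a' E').
rewrite (tens_superopDr E) (tens_superopDr E').
rewrite (tens_superopZr b E) (tens_superopZr b' E) (tens_superopZr b E') (tens_superopZr b' E').
move: (tens_superop E F) (tens_superop E F') (tens_superop E' F) (tens_superop E' F').
by move=> P Q S T; rewrite !scalerDr !scalerA.
Qed.

(** Two products of local operations realize the pair of conjugate cross terms. This is the origin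
    of the factor 2 in the cost. *)
Lemma tens_cross_term d (A B A' B' : 'M[C]_d) c :
  tens_superop (cross_term A B c) (cross_term A' B' 1)
    - tens_superop (cross_term A B (c * 'i%R)) (cross_term A' B' 'i%R)
  = 2%:R^-1 *: (c *: sandwich (A *t A') (B *t B') + c^* *: sandwich (B *t B') (A *t A')).
Proof.
have expand a b : tens_superop (cross_term A B a) (cross_term A' B' b) =
    2%:R^-1 *: (2%:R^-1 *: ((a * b) *: sandwich (A *t A') (B *t B')
    + (a * b^*) *: sandwich (A *t B') (B *t A')
    + ((a^* * b) *: sandwich (B *t A') (A *t B')
    + (a^* * b^*) *: sandwich (B *t B') (A *t A')))).
  rewrite /cross_term (tens_superopZl 2%:R^-1) (tens_superopZr 2%:R^-1) tens_superop_comb.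
  rewrite (tens_sandwich A B A' B') (tens_sandwich A B B' A').
  by rewrite (tens_sandwich B A A' B') (tens_sandwich B A B' A').
apply: etrans (congr2 (fun X Y => X - Y) (expand c 1) (expand (c * 'i%R) 'i%R)) _.
exact: (quarter_turn_cancel c (sandwich (A *t A') (B *t B')) (sandwich (A *t B') (B *t A'))
                              (sandwich (B *t A') (A *t B')) (sandwich (B *t B') (A *t A'))).
Qed.

Lemma LO_tens_cross_term d (A B A' B' : 'M[C]_d) c c' :
  A \is unitarymx -> B \is unitarymx -> A' \is unitarymx -> B' \is unitarymx ->
  `|c| = 1 -> `|c'| = 1 ->
  LO d d (tens_superop (cross_term A B c) (cross_term A' B' c')).
Proof.
move=> *; exists (cross_term A B c), (cross_term A' B' c').
by split=> //; apply: signed_local_cross_term.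
Qed.

(** The diagonal terms have weights [r k ^+ 2], of sum 1, and each ordered pair contributes twice
    the weight [r k * r l]. The real function [r] gives the moduli in [R], where costs live. *)
Lemma LO_cost (I : finType) d (F G : I -> 'M[C]_d) (u : I -> C) (r : I -> R) :
  (forall k, F k \is unitarymx) -> (forall k, G k \is unitarymx) ->
  (forall k, `|u k| = (r k)%:C) -> (forall k, 0 <= r k) -> \sum_k r k ^+ 2 = 1 ->
  decomposition_costs (LO d d) (unitary_channel (\sum_k u k *: (F k *t G k)))
    (1 + 2 * \sum_k \sum_(l | k != l) r k * r l).
Proof.
move=> uF uG norm_u r_ge0 sum_r2.
pose e k := phase (u k); have he k : `|e k| = 1 := norm_phase (u k).
pose c k l := e k * (e l)^*; have hc k l : `|c k l| = 1.
  by rewrite /c normrM norm_conjC !he mulr1.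
(* Weight zero on the diagonal allows all of [I * I] as index type. *)
pose alpha k l := if k == l then 0 else r k * r l.
have alpha_ge0 k l : 0 <= alpha k l by rewrite /alpha; case: ifP => // _; apply: mulr_ge0.
pose a (t : I + (I * I) + (I * I)) : R := match t with
  | inl (inl k) => r k ^+ 2
  | inl (inr (k, l)) => alpha k l
  | inr (k, l) => - alpha k l end.
pose H (t : I + (I * I) + (I * I)) : superop R (d * d) (d * d) := match t with
  | inl (inl k) => tens_superop (cross_term (F k) (F k) 1) (cross_term (G k) (G k) 1)
  | inl (inr (k, l)) =>
      tens_superop (cross_term (F k) (F l) (c k l)) (cross_term (G k) (G l) 1)
  | inr (k, l) =>
      tens_superop (cross_term (F k) (F l) (c k l * 'i%R)) (cross_term (G k) (G l) 'i%R) end.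
have -> : 1 + 2 * \sum_k \sum_(l | k != l) r k * r l = \sum_t `|a t|.
  rewrite !big_sumType /= -addrA; congr (_ + _).
    by rewrite -sum_r2; apply: eq_bigr => k _; rewrite ger0_norm ?sqr_ge0.
  have -> : \sum_k \sum_(l | k != l) r k * r l = \sum_p alpha p.1 p.2.
    rewrite -(pair_bigA _ alpha); apply: eq_bigr => k _; rewrite big_mkcond.
    by apply: eq_bigr => l _; rewrite /alpha; case: eqP.
  rewrite mulrDl mul1r; congr (_ + _); apply: eq_bigr => -[k l] _ /=.
    by rewrite ger0_norm.
  by rewrite normrN ger0_norm.
apply: (decomposition_costs_fin (F := H)).
(* A decomposition has at least one term; [I] is inhabited because the squares sum to 1. *)
- suff [k _] : exists k : I, true by apply/card_gt0P; exists (inl (inl k)).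
  case: (pickP (@predT I)) => [k _|no_k]; first by exists k.
  by move/eqP: sum_r2; rewrite big_pred0 // eq_sym oner_eq0.
- move=> [[k|[k l]]|[k l]].
  + exact: (LO_tens_cross_term (uF k) (uF k) (uG k) (uG k) (normr1 _) (normr1 _)).
  + exact: (LO_tens_cross_term (uF k) (uF l) (uG k) (uG l) (hc k l) (normr1 _)).
  + apply: (LO_tens_cross_term (uF k) (uF l) (uG k) (uG l) _ (normCi _)).
    by rewrite normrM hc normCi mulr1.
have -> : unitary_channel (\sum_k u k *: (F k *t G k)) =
    \sum_k \sum_l (u k * (u l)^*) *: sandwich (F k *t G k) (F l *t G l).
  rewrite unitary_channel_sandwich sandwich_suml; apply: eq_bigr => k _.
  rewrite sandwichZl sandwich_sumr scaler_sumr; apply: eq_bigr => l _.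
  by rewrite sandwichZr scalerA.
have ue k : u k = `|u k| * e k by exact: normMphase.
rewrite (hermitian_double_sum (fun k l => sandwich (F k *t G k) (F l *t G l)) ue).
rewrite 2!big_sumType /= -[RHS]addrA; congr (_ + _).
  apply: eq_bigr => k _; rewrite norm_u (cross_term_diag (F k)) (cross_term_diag (G k)).
  by rewrite tens_sandwich rmorphXn.
rewrite pair_big -big_split; apply: eq_bigr => -[k l] _ /=.
rewrite -(tens_cross_term (F k) (F l) (G k) (G l) (c k l)) 2!norm_u.
have -> : (if k == l then 0 else (r k)%:C * (r l)%:C) = (alpha k l)%:C.
  by rewrite /alpha; case: ifP => _; rewrite ?rmorph0 ?rmorphM.
by rewrite /= rmorphN scalerBr scaleNr.
Qed.

End UpperBound.

(** * Local rotations and tensor products of unitary bases *)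

Section Bases.
Local Open Scope sesquilinear_scope.
Context {C : numClosedFieldType}.

(** The twirl form is free of coordinates, which makes completeness easy to transport along
    unitaries. Conversely, entries are recovered by twirling matrix units. *)
Lemma completeness_twirl (I : finType) d (F : I -> 'M[C]_d) :
  (forall x y x' y',
     \sum_k F k x y * (F k x' y')^* = d%:R * ((x == x') && (y == y'))%:R) <->
  (forall X, \sum_k F k *m X *m (F k)^t* = (d%:R * \tr X)%:M).
Proof.
split=> [complete X|twirl x y x' y'].
  apply/matrixP => x x'; rewrite summxE !mxE.
  have -> : \sum_k (F k *m X *m (F k)^t*) x x' =
      \sum_y \sum_y' X y' y * \sum_k F k x y' * (F k x' y)^*.
    under [RHS]eq_bigr do under eq_bigr do rewrite mulr_sumr.
    under [RHS]eq_bigr do rewrite exchange_big.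
    rewrite [RHS]exchange_big; apply: eq_bigr => k _; rewrite mxE.
    apply: eq_bigr => y _; rewrite !mxE mulr_suml; apply: eq_bigr => y' _ /=.
    by ring.
  rewrite /mxtrace [in RHS]mulr_sumr -sumrMnl; apply: eq_bigr => y _.
  rewrite (bigD1 y) //= [X in _ + X = _]big1 => [|y' /negPf yy']; rewrite complete.
    by rewrite eqxx andbT addr0 -[RHS]mulr_natr; ring.
  by rewrite yy' andbF !mulr0.
have := congr1 (fun A : 'M_d => A x x') (twirl (delta_mx y y')); rewrite summxE => tw.
transitivity (\sum_k (F k *m delta_mx y y' *m (F k)^t*) x x').
  by apply: eq_bigr => k _; rewrite mul_delta_mx_mulE !mxE.
rewrite tw !mxE /mxtrace (bigD1 y) //= big1 => [|z /negPf zy]; last by rewrite mxE zy.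
by rewrite mxE eqxx addr0 -mulrnAr -mulrnA mulnb andbC.
Qed.

(** For completeness, conjugation by [W] inside the twirl preserves the trace, and conjugation by
    [V] outside fixes scalar matrices. *)
Lemma unitary_basis_mul (I : finType) d (F : I -> 'M[C]_d) (V W : 'M[C]_d) :
  V \is unitarymx -> W \is unitarymx -> unitary_basis F ->
  unitary_basis (fun k => V *m F k *m W).
Proof.
move=> uV uW [uF orthF /completeness_twirl twirl].
have VV : V^t* *m V = 1%:M by rewrite -invmx_unitary // mulVmx ?unitarymx_unit.
split=> [k|k l|]; first by rewrite !mul_unitarymx.
  rewrite -orthF !adjmxM !mulmxA mxtrace_mulC !mulmxA (unitarymxP uW) mul1mx.
  by rewrite -[_ *m V^t* *m V]mulmxA VV mulmx1.
apply/completeness_twirl => X.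
have -> : \sum_k V *m F k *m W *m X *m (V *m F k *m W)^t* =
    V *m (\sum_k F k *m (W *m X *m W^t*) *m (F k)^t*) *m V^t*.
  rewrite mulmx_sumr mulmx_suml; apply: eq_bigr => k _.
  by rewrite !adjmxM !mulmxA.
rewrite twirl mxtrace_mulC mulmxA -[W^t*]invmx_unitary // mulVmx ?unitarymx_unit //.
by rewrite mul1mx mul_mx_scalar -scalemxAl (unitarymxP uV) scalemx1.
Qed.

Lemma prod_natb (I : finType) (b : I -> bool) :
  \prod_i (b i)%:R = [forall i, b i]%:R :> C.
Proof.
case: forallP => [all_b|not_b]; first by rewrite big1 // => i _; rewrite all_b.
have [i /negPf bi] : exists i, ~~ b i.
  by apply/existsP; rewrite -negb_forall; apply/forallP.
by rewrite (bigD1 i) //= bi mul0r.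
Qed.

Lemma bits_eq n (a b : 'I_(qubits_dim n)) : [forall i, bits a i == bits b i] = (a == b).
Proof.
apply/forallP/eqP => [ab|-> //]; apply: enum_val_inj; apply/ffunP => i.
exact/eqP/ab.
Qed.

Lemma sum_bits (n : nat) (g : 'I_n -> 'I_2 -> C) :
  \sum_a \prod_i g i (bits a i) = \prod_i \sum_x g i x.
Proof.
rewrite bigA_distr_bigA /=.
by rewrite (big_enum_val (fun x : {ffun 'I_n -> 'I_2} => \prod_i g i (x i))).
Qed.

Lemma sum_bits2 (n : nat) (g : 'I_n -> 'I_2 -> 'I_2 -> C) :
  \sum_a \sum_b \prod_i g i (bits a i) (bits b i) = \prod_i \sum_x \sum_y g i x y.
Proof.
rewrite -(sum_bits (fun i x => \sum_y g i x y)); apply: eq_bigr => a _.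
exact: sum_bits.
Qed.

(** The [n]-fold Kronecker product given by entries through [bits], which matches [tens_unitaries]
    and avoids dimension casts. *)
Definition tens_family (I : finType) n (F : 'I_n -> I -> 'M[C]_2)
    (k : {ffun 'I_n -> I}) : 'M[C]_(qubits_dim n) :=
  \matrix_(a, b) \prod_i F i (k i) (bits a i) (bits b i).

Lemma natr_qubits_dim n : (qubits_dim n)%:R = \prod_(i < n) 2%:R :> C.
Proof. by rewrite qubits_dimE natrX prodr_const card_ord. Qed.

(** Each clause factorizes over the qubits by distributivity, its Kronecker delta being a product of
    single-qubit deltas. *)
Lemma unitary_basis_tens (I : finType) n (F : 'I_n -> I -> 'M[C]_2) :
  (forall i, unitary_basis (F i)) -> unitary_basis (tens_family F).
Proof.
move=> hF; split=> [k|k l|a b a' b'].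
- apply/unitarymxP/matrixP => a b; rewrite !mxE.
  transitivity (\sum_c \prod_i (F i (k i) (bits a i) (bits c i)
                               * (F i (k i) (bits b i) (bits c i))^*)).
    by apply: eq_bigr => c _; rewrite !mxE rmorph_prod -big_split.
  rewrite (sum_bits (fun i x => F i (k i) (bits a i) x * (F i (k i) (bits b i) x)^*)).
  rewrite -bits_eq -prod_natb; apply: eq_bigr => i _.
  have [uF _ _] := hF i; have /matrixP/(_ (bits a i) (bits b i)) := unitarymxP (uF (k i)).
  by rewrite !mxE => <-; apply: eq_bigr => x _; rewrite !mxE.
- rewrite mxtrace_mul.
  transitivity (\sum_b \sum_a \prod_i ((F i (k i) (bits a i) (bits b i))^*
                                      * F i (l i) (bits a i) (bits b i))).
    by apply: eq_bigr => b _; apply: eq_bigr => a _; rewrite !mxE rmorph_prod -big_split.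
  rewrite (sum_bits2 (fun i x y => (F i (k i) y x)^* * F i (l i) y x)) natr_qubits_dim.
  have -> : (k == l) = [forall i, k i == l i].
    by apply/eqP/forallP => [-> //|kl]; apply/ffunP => i; exact/eqP/kl.
  rewrite -prod_natb -big_split; apply: eq_bigr => i _ /=.
  have [_ orthF _] := hF i; rewrite -orthF mxtrace_mul.
  by apply: eq_bigr => x _; apply: eq_bigr => y _; rewrite !mxE.
transitivity (\sum_(k : {ffun 'I_n -> I}) \prod_i
  (F i (k i) (bits a i) (bits b i) * (F i (k i) (bits a' i) (bits b' i))^*)).
  by apply: eq_bigr => k _; rewrite !mxE rmorph_prod -big_split.
rewrite -(bigA_distr_bigA (fun i j =>
  F i j (bits a i) (bits b i) * (F i j (bits a' i) (bits b' i))^*)).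
rewrite natr_qubits_dim -!bits_eq -mulnb natrM -!prod_natb -!big_split.
apply: eq_bigr => i _ /=; have [_ _ ->] := hF i.
by rewrite -mulnb natrM.
Qed.

End Bases.

(** * Pauli matrices and the KAK form *)

Section Qubits.
Local Open Scope sesquilinear_scope.
Context {R : realType}.
Local Notation C := R[i].

Lemma conj_im : ('i%C : C)^*%R = - 'i%C.
Proof. by apply/eqP; rewrite eq_complex /= oppr0 !eqxx. Qed.

Lemma mul_im : 'i%C * 'i%C = -1 :> C.
Proof. by rewrite -expr2 sqr_i. Qed.

Lemma ord2P (P : 'I_2 -> Prop) : P 0 -> P 1 -> forall i, P i.
Proof.
move=> P0 P1 [[|[|//]] hi].
- by rewrite (_ : Ordinal hi = 0) //; apply: val_inj.
- by rewrite (_ : Ordinal hi = 1) //; apply: val_inj.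
Qed.

Lemma ord4P (P : 'I_4 -> Prop) : P 0 -> P 1 -> P 2%:R -> P 3%:R -> forall i, P i.
Proof.
move=> P0 P1 P2 P3 [[|[|[|[|//]]]] hi].
- by rewrite (_ : Ordinal hi = 0) //; apply: val_inj.
- by rewrite (_ : Ordinal hi = 1) //; apply: val_inj.
- by rewrite (_ : Ordinal hi = 2%:R) //; apply: val_inj.
- by rewrite (_ : Ordinal hi = 3%:R) //; apply: val_inj.
Qed.

Lemma sum_ord2 (V : nmodType) (f : 'I_2 -> V) : \sum_i f i = f 0 + f 1.
Proof.
rewrite 2!big_ord_recl big_ord0 addr0; congr (_ + f _); exact: val_inj.
Qed.

Lemma sum_ord4 (V : nmodType) (f : 'I_4 -> V) :
  \sum_i f i = f 0 + f 1 + f 2%:R + f 3%:R.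
Proof.
rewrite 4!big_ord_recl big_ord0 addr0 !addrA.
by congr (_ + f _ + f _ + f _); apply: val_inj.
Qed.

(** The equations are packed as a tuple so that they act as one multirule for rewriting. *)
Lemma pauli_entries :
  (((@pauli R 0 0 0 = 1) * (@pauli R 0 0 1 = 0) * (@pauli R 0 1 0 = 0) * (@pauli R 0 1 1 = 1)) *
   ((@pauli R 1 0 0 = 0) * (@pauli R 1 0 1 = 1) * (@pauli R 1 1 0 = 1) * (@pauli R 1 1 1 = 0)) *
   ((@pauli R 2%:R 0 0 = 0) * (@pauli R 2%:R 0 1 = - 'i%C) * (@pauli R 2%:R 1 0 = 'i%C)
      * (@pauli R 2%:R 1 1 = 0)) *
   ((@pauli R 3%:R 0 0 = 1) * (@pauli R 3%:R 0 1 = 0) * (@pauli R 3%:R 1 0 = 0)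
      * (@pauli R 3%:R 1 1 = -1)))%type.
Proof. by do !split; rewrite /pauli /= mxE. Qed.

Lemma conj_pauli_entries :
  (((0 : C)^*%R = 0) * ((1 : C)^*%R = 1) * ((- 1 : C)^*%R = -1)
   * (('i%C : C)^*%R = - 'i%C) * ((- 'i%C : C)^*%R = 'i%C))%type.
Proof.
by rewrite rmorph0 rmorph1 rmorphN1 (rmorphN Num.conj 'i%C) /= conj_im opprK.
Qed.

(** A finite check over indices and entries, in which [mul_im] supplies the square of the imaginary
    unit. *)
Lemma unitary_basis_pauli : unitary_basis (@pauli R).
Proof.
split.
- move=> k; apply/unitarymxP/matrixP => x y; rewrite mxE sum_ord2 !(mxE, mxE) /=.
  move: x y; apply: ord2P; apply: ord2P; move: k; apply: ord4P;
  rewrite !pauli_entries !conj_pauli_entries /=; ring: mul_im.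
- move=> k l; rewrite mxtrace_mul !sum_ord2 !mxE.
  by move: k l; apply: ord4P; apply: ord4P;
  rewrite !pauli_entries !conj_pauli_entries /=; ring: mul_im.
move=> x y x' y'; rewrite sum_ord4.
by move: x y x' y'; do 4![apply: ord2P];
  rewrite !pauli_entries !conj_pauli_entries /=; ring: mul_im.
Qed.

(** The local unitaries are absorbed into the two bases. These form one pair, so that a single
    finite choice over all [i] yields both. *)
Lemma KAK_bases (U : 'M[C]_(2 * 2)) (u : 'I_4 -> C) : KAK_parameters U u ->
  exists FG : ('I_4 -> 'M[C]_2) * ('I_4 -> 'M[C]_2),
    [/\ unitary_basis FG.1, unitary_basis FG.2 & U = \sum_k u k *: (FG.1 k *t FG.2 k)].
Proof.
case=> _ [V1 [V2 [V3 [V4 [uV1 uV2 uV3 uV4 ->]]]]].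
exists (fun k => V1 *m pauli k *m V3, fun k => V2 *m pauli k *m V4); split=> /=.
- exact: (unitary_basis_mul uV1 uV3 unitary_basis_pauli).
- exact: (unitary_basis_mul uV2 uV4 unitary_basis_pauli).
rewrite mulmx_sumr mulmx_suml; apply: eq_bigr => k _.
by rewrite -scalemxAr -scalemxAl !tensmx_mul.
Qed.

(** Distributing the entrywise product over the sums turns the index into a string [k], with
    coefficient the product of the [u i (k i)]. *)
Lemma tens_unitaries_comb (I : finType) n (U : 'I_n -> 'M[C]_(2 * 2))
    (F G : 'I_n -> I -> 'M[C]_2) (u : 'I_n -> I -> C) :
  (forall i, U i = \sum_k u i k *: (F i k *t G i k)) ->
  tens_unitaries U = \sum_(k : {ffun 'I_n -> I})
    (\prod_i u i (k i)) *: (tens_family F k *t tens_family G k).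
Proof.
move=> defU; apply/matrixP => x y.
case: (mxtens_indexP x) => a b; case: (mxtens_indexP y) => a' b'.
rewrite summxE mxE !mxtens_indexK.
transitivity (\prod_i \sum_k u i k * (F i k (bits a i) (bits a' i)
                                      * G i k (bits b i) (bits b' i))).
  apply: eq_bigr => i _; rewrite defU summxE; apply: eq_bigr => k _.
  by rewrite mxE tensmxE.
rewrite bigA_distr_bigA; apply: eq_bigr => k _.
by rewrite !big_split mxE tensmxE !mxE.
Qed.

End Qubits.

Theorem corollary4p1 (R : realType) (n : nat)
    (U : 'I_n -> 'M[R[i]]_(2 * 2)) (u : 'I_n -> 'I_4 -> R[i])
    (hU : forall i, U i \is unitarymx)
    (hu : forall i, KAK_parameters (U i) (u i)) :
  let uu (k : {ffun 'I_n -> 'I_4}) : R[i] := \prod_(i < n) u i (k i) in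
  let g : R :=
    1 + 2 * \sum_(k : {ffun 'I_n -> 'I_4})
              \sum_(k' : {ffun 'I_n -> 'I_4} | k != k')
                ComplexField.Normc.normc (uu k) * ComplexField.Normc.normc (uu k') in
  is_gamma (LO (qubits_dim n) (qubits_dim n))
    (unitary_channel (tens_unitaries U)) g /\
  is_gamma (LOCC (qubits_dim n) (qubits_dim n))
    (unitary_channel (tens_unitaries U)) g.
Proof.
move=> uu g.
have [FG hFG] := fin_all_exists (fun i => KAK_bases (hu i)).
pose F i := (FG i).1; pose G i := (FG i).2.
have hF : unitary_basis (tens_family F).
  by apply: unitary_basis_tens => i; case: (hFG i).
have hG : unitary_basis (tens_family G).
  by apply: unitary_basis_tens => i; case: (hFG i).
have -> : tens_unitaries U = \sum_k uu k *: (tens_family F k *t tens_family G k).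
  by apply: tens_unitaries_comb => i; case: (hFG i).
pose r k := ComplexField.Normc.normc (uu k).
have norm_uu k : `|uu k| = (r k)%:C by [].
have r_ge0 k : 0 <= r k by rewrite -ler0c -norm_uu.
(* The normalization factorizes over the [n] unitaries. *)
have sum_uu2 : \sum_k `|uu k| ^+ 2 = 1.
  transitivity (\prod_i \sum_k `|u i k| ^+ 2).
    rewrite bigA_distr_bigA; apply: eq_bigr => k _.
    by rewrite normr_prod -prodrXl.
  by rewrite big1 // => i _; case: (hu i).
have sum_r2 : \sum_k r k ^+ 2 = 1.
  apply: complexI; rewrite rmorph1 -sum_uu2 rmorph_sum; apply: eq_bigr => k _.
  by rewrite norm_uu rmorphXn.
have costLO : decomposition_costs (LO (qubits_dim n) (qubits_dim n))
    (unitary_channel (\sum_k uu k *: (tens_family F k *t tens_family G k))) g.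
  have [uF _ _] := hF; have [uG _ _] := hG.
  exact: (LO_cost uF uG norm_uu r_ge0 sum_r2).
(* The square of the sum of moduli splits into its diagonal, equal to 1, and the off-diagonal sum in
   [g]. *)
have gE : g = 2 * (\sum_k r k) ^+ 2 - 1.
  have -> : (\sum_k r k) ^+ 2 = 1 + \sum_k \sum_(l | k != l) r k * r l.
    rewrite -sum_r2 expr2 big_distrlr -big_split; apply: eq_bigr => k _ /=.
    by rewrite (bigD1 k) //= expr2; congr (_ + _); apply: eq_bigl => l; rewrite eq_sym.
  by rewrite /g; ring.
have g_lb : lbound (decomposition_costs (LOCC (qubits_dim n) (qubits_dim n))
    (unitary_channel (\sum_k uu k *: (tens_family F k *t tens_family G k)))) g.
  move=> c costc; rewrite -lecR gE rmorphB rmorphM rmorphXn rmorph_sum rmorph1 rmorph_nat.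
  apply: (LOCC_cost_ge _ hF hG sum_uu2 costc).
  by rewrite qubits_dimE expn_gt0.
(* Since LO maps are LOCC maps, the LO decomposition attains [g] for both sets, and the LOCC lower
   bound holds for both. *)
have costLOCC := decomposition_costs_subset (@LO_LOCC R _ _) costLO.
split; split=> // c costc; apply: g_lb.
exact: decomposition_costs_subset (@LO_LOCC R _ _) costc.
Qed.
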